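(* Let $n\geq 4$ be even and let $f:E^{n+1}_0\to\{0,1\}$ be given by $$f(x_0,\ldots,x_n)=\sum_{i=0}^{n}\sum_{j=1}^{\lfloor n/4\rfloor}x_i x_{i+j}\pmod 2,$$ with indices taken modulo $n+1$. Then: (a) The $n$-quasigroup $Q_{0,f}$ is irreducible. (b) For every $i\in\{0,\ldots,n\}$ and every $[\alpha,\gamma]\in Z_2^2$, the $(n-1)$-ary retract $Q^i_{[\alpha,\gamma]}$ obtained from $Q_{0,f}$ by fixing the $i$th variable $[x_i,y_i]:=[\alpha,\gamma]$ is reducible. (c) $Q_{0,f}$ has an irreducible $(n-2)$-ary retract.
   Context: An $n$-ary operation $Q:\Sigma^n\to\Sigma$ ($\Sigma$ nonempty) is an $n$-ary quasigroup ($n$-quasigroup) of order $|\Sigma|$ if in $z_0=Q(z_1,\ldots,z_n)$ any $n$ of the elements $z_0,\ldots,z_n$ uniquely determine the remaining one. Write $Q\langle z_0,\ldots,z_n\rangle$ for the predicate $z_0=Q(z_1,\ldots,z_n)$. Retracts: fixing the values of $l\le n$ of the variables $z_0,\ldots,z_n$ in the predicate $Q\langle z_0,\ldots,z_n\rangle$ gives an $(n-l+1)$-ary predicate, which corresponds to an $(n-l)$-quasigroup, called a retract of $Q$. (Note that the variable $z_0$ may also be fixed; the remaining variables are taken in their natural order.) Reducibility: an $n$-quasigroup $Q$ is $A$-reducible, where $A=\{a_1,\ldots,a_k\}\subseteq\{0,\ldots,n\}$ has complement $\{b_1,\ldots,b_{n-k+1}\}$ in $\{0,\ldots,n\}$,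 if there are a $k$-quasigroup $Q'$ and an $(n-k+1)$-quasigroup $Q''$ on $\Sigma$ with $$Q\langle z_0,\ldots,z_n\rangle\iff Q'(z_{a_1},\ldots,z_{a_k})=Q''(z_{b_1},\ldots,z_{b_{n-k+1}}).$$ $Q$ is (permutably) reducible if it is $A$-reducible for some $A\subset\{0,\ldots,n\}$ with $1<|A|<n$; otherwise it is irreducible. For an $m$-ary retract the same definitions apply with $m$ in place of $n$. The quasigroups $Q_{\alpha,\lambda}$: all arithmetic on $\{0,1\}$ is modulo 2. For $\alpha\in\{0,1\}$ let $E^{n+1}_\alpha=\{(x_0,\ldots,x_n)\in\{0,1\}^{n+1}: x_0+\ldots+x_n=\alpha\}$. Let $\Sigma=Z_2^2$, with elements written $[x,y]$. For $\lambda:E^{n+1}_\alpha\to\{0,1\}$, the $n$-quasigroup $Q_{\alpha,\lambda}$ of order 4 on $\Sigma$ is defined by $$Q_{\alpha,\lambda}\langle[x_0,y_0],\ldots,[x_n,y_n]\rangle\iff x_0+\ldots+x_n=\alpha\ \text{ and }\ y_0+\ldots+y_n=\lambda(x_0,\ldots,x_n).$$ *)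

(* Defs.v *)
From HB Require Import structures.
From mathcomp Require Import all_boot all_order all_algebra.

Set Implicit Arguments.
Unset Strict Implicit.
Unset Printing Implicit Defensive.

Import GRing.Theory.
Local Open Scope ring_scope.

(* The predicate Q<z_0, ..., z_n>, i.e. z_0 = Q(z_1, ..., z_n). *)
Definition op_graph (S : Type) (n : nat) (Q : {ffun 'I_n -> S} -> S)
    (z : {ffun 'I_n.+1 -> S}) : Prop :=
  z ord0 = Q [ffun i => z (lift ord0 i)].

Definition set_var (S : Type) (n : nat) (z : {ffun 'I_n -> S})
    (i : 'I_n) (v : S) : {ffun 'I_n -> S} :=
  [ffun j => if j == i then v else z j].

(* The value of [z] at [i] is irrelevant: the other n entries determine the
   i-th one. *)
Definition is_quasigroup (S : Type) (n : nat) (Q : {ffun 'I_n -> S} -> S) : Prop :=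
  forall (i : 'I_n.+1) (z : {ffun 'I_n.+1 -> S}),
    exists! v : S, op_graph Q (set_var z i v).

Structure quasigroup (S : Type) (n : nat) := Quasigroup {
  qop :> {ffun 'I_n -> S} -> S;
  qopP : is_quasigroup qop
}.

(* [R] is the m-ary retract of [Q] obtained by fixing z_i := c_i for i in [L].
   The increasing [h] enumerates the free variables in their natural order, so
   [L], [c] determine m = n - #|L|, [h], and the operation of [R]. Variable 0
   may be fixed; then [R] is solved for the first free variable. *)
Definition is_retract (S : Type) (n m : nat) (Q : quasigroup S n)
    (L : {set 'I_n.+1}) (c : 'I_n.+1 -> S) (R : quasigroup S m) : Prop :=
  exists h : 'I_m.+1 -> 'I_n.+1,
    [/\ forall j k : 'I_m.+1, (j < k)%N -> (h j < h k)%N,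
        forall i : 'I_n.+1, i \notin L <-> exists j : 'I_m.+1, h j = i
      & forall z : {ffun 'I_n.+1 -> S}, (forall i, i \in L -> z i = c i) ->
          (op_graph R [ffun j => z (h j)] <-> op_graph Q z)].

(* [enum_val] lists the elements of a set of ordinals in increasing order;
   #|~: A| = n - #|A| + 1. *)
Definition set_reducible (S : Type) (n : nat) (Q : quasigroup S n)
    (A : {set 'I_n.+1}) : Prop :=
  exists (Q' : quasigroup S #|A|) (Q'' : quasigroup S #|~: A|),
    forall z : {ffun 'I_n.+1 -> S},
      op_graph Q z <->
      Q' [ffun k => z (@enum_val _ (mem A) k)]
        = Q'' [ffun k => z (@enum_val _ (mem (~: A)) k)].

Definition reducible (S : Type) (n : nat) (Q : quasigroup S n) : Prop :=
  exists A : {set 'I_n.+1}, (1 < #|A| < n)%N /\ set_reducible Q A.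

Definition irreducible (S : Type) (n : nat) (Q : quasigroup S n) : Prop :=
  ~ reducible Q.

Definition E (n : nat) (alpha : 'Z_2) : Type :=
  {x : {ffun 'I_n.+1 -> 'Z_2} | \sum_i x i == alpha}.

Definition Z22 : Type := ('Z_2 * 'Z_2)%type.

Definition complete (n : nat) (alpha : 'Z_2) (x : {ffun 'I_n -> 'Z_2}) :
    {ffun 'I_n.+1 -> 'Z_2} :=
  [ffun i => if unlift ord0 i is Some j then x j else alpha - \sum_j x j].

Lemma complete_sum (n : nat) (alpha : 'Z_2) (x : {ffun 'I_n -> 'Z_2}) :
  \sum_i complete alpha x i == alpha.
Proof.
rewrite big_ord_recl ffunE unlift_none.
rewrite [X in _ + X](_ : _ = \sum_j x j) ?subrK //.
by apply: eq_bigr => j _; rewrite ffunE liftK.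
Qed.

Definition complete_E (n : nat) (alpha : 'Z_2) (x : {ffun 'I_n -> 'Z_2}) :
    E n alpha :=
  exist _ (complete alpha x) (complete_sum alpha x).

(* The predicate of Q_{alpha,lambda}, solved for [x_0, y_0];
   see [Qop_graphP]. *)
Definition Qop (n : nat) (alpha : 'Z_2) (lam : E n alpha -> 'Z_2)
    (w : {ffun 'I_n -> Z22}) : Z22 :=
  let x := [ffun i => (w i).1] in
  (alpha - \sum_i x i, lam (complete_E alpha x) - \sum_i (w i).2).

Lemma Qop_graphP (n : nat) (alpha : 'Z_2) (lam : E n alpha -> 'Z_2)
    (z : {ffun 'I_n.+1 -> Z22}) :
  op_graph (Qop lam) z <->
  exists x : E n alpha,
    (forall i, val x i = (z i).1) /\ \sum_i (z i).2 = lam x.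
Proof.
rewrite /op_graph /Qop; set t := [ffun i => (_ i).1].
have tE j : t j = (z (lift ord0 j)).1 by rewrite !ffunE.
have s2 : \sum_i ([ffun i => z (lift ord0 i)] i).2
    = \sum_i (z (lift ord0 i)).2 by apply: eq_bigr => i _; rewrite ffunE.
split=> [z0|[x [xz sy]]].
  exists (complete_E alpha t); split=> [i|].
    rewrite /= ffunE; case: unliftP => [j|] ->; first by rewrite tE.
    by rewrite z0.
  by rewrite big_ord_recl z0 /= s2 subrK.
have st : alpha - \sum_j t j = val x ord0.
  have xs : \sum_i val x i = alpha by exact: (eqP (valP x)).
  rewrite -[X in X - _]xs big_ord_recl.
  rewrite [X in _ - X](_ : _ = \sum_j val x (lift ord0 j)) ?addrK //.
  by apply: eq_bigr => j _; rewrite tE xz.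
have -> : complete_E alpha t = x.
  apply: val_inj; apply/ffunP => i; rewrite /= ffunE.
  by case: unliftP => [j|] ->; rewrite ?st // tE xz.
rewrite st -sy s2 big_ord_recl addrK xz.
exact: surjective_pairing.
Qed.

Lemma Qop_quasigroup (n : nat) (alpha : 'Z_2) (lam : E n alpha -> 'Z_2) :
  is_quasigroup (Qop lam).
Proof.
move=> i z.
set a := alpha - \sum_(j | j != i) (z j).1.
pose x := [ffun j => if j == i then a else (z j).1].
have sum_ne (F G : 'I_n.+1 -> 'Z_2) (v : 'Z_2) :
  (forall j, G j = if j == i then v else F j) ->
  \sum_j G j = v + \sum_(j | j != i) F j.
  move=> GE; rewrite (bigD1 i) //= GE eqxx; congr (_ + _).
  by apply: eq_bigr => j /negbTE ji; rewrite GE ji.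
have xP : \sum_j x j == alpha.
  rewrite (sum_ne (fun j => (z j).1) _ a) ?subrK // => j.
  by rewrite ffunE.
pose xE : E n alpha := exist _ x xP.
exists (a, lam xE - \sum_(j | j != i) (z j).2); split.
  apply/Qop_graphP; exists xE; split=> [j|].
    by rewrite /= !ffunE; case: ifP.
  rewrite (sum_ne (fun j => (z j).2) _ (lam xE - \sum_(j | j != i) (z j).2)).
    by rewrite subrK.
  by move=> j; rewrite ffunE; case: ifP.
case=> v1 v2 /Qop_graphP [x' [x'z sy]].
have v1E : v1 = a.
  have xs : \sum_j val x' j = alpha by exact: (eqP (valP x')).
  rewrite /a -[X in X - _]xs.
  rewrite (sum_ne (fun j => (z j).1) _ v1) ?addrK // => j.
  by rewrite x'z ffunE; case: ifP.
have x'E : x' = xE.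
  apply: val_inj; apply/ffunP => j.
  by rewrite x'z /= !ffunE; case: ifP => // _; rewrite v1E.
move: sy; rewrite (sum_ne (fun j => (z j).2) _ v2); last first.
  by move=> j; rewrite ffunE; case: ifP.
by rewrite x'E v1E => <-; rewrite addrK.
Qed.

Definition Qlam (n : nat) (alpha : 'Z_2) (lam : E n alpha -> 'Z_2) :
    quasigroup Z22 n :=
  Quasigroup (Qop_quasigroup lam).

(* [inZp k : 'I_n.+1] is the residue of k modulo n+1. *)
Definition fcirc (n : nat) (x : E n 0) : 'Z_2 :=
  \sum_(i < n.+1) \sum_(1 <= j < (n %/ 4)%N.+1)
    val x i * val x (inZp (i + j)%N).

(* Main.v *)
Require Import Defs.
From mathcomp Require Import all_boot all_order all_algebra.
From mathcomp Require Import zify ring.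

(* Write m = n/2, so that there are n + 1 = 2m + 1 variables, and let G be the
   circulant graph of the quadratic form f. If the first coordinates of the
   variables are restricted to a set A and its complement, f splits as
   g(x_A) + h(x_B) on vectors of fixed parity iff every 4-cycle i j i' j'
   with i, i' in A and j, j' in B meets an even number of edges of G. Fixing
   variables deletes vertices of G, and the parity of such 4-cycles is
   invariant under Seidel switching.
   Doubling vertices modulo n + 1 and switching the upper half turns the
   complement of G into the graph p ~ q iff |p - q| > m on {0, ..., 2m}: the
   vertex m is isolated and the others form a half graph. A set A avoiding m
   without odd 4-cycle is a module of it, and a half graph has no nontrivial
   module; this is (a). Deleting the positions m - 1 and 2m leaves a smaller
   half graph with an isolated vertex, which gives (c). For (b), after
   deletion of i the vertices i + r and i - r with r = m - floor(n/4) have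
   complementary neighbourhoods, so A = {i + r, i - r} splits. *)

Set Implicit Arguments.
Unset Strict Implicit.
Unset Printing Implicit Defensive.

Import GRing.Theory.
Local Open Scope ring_scope.

(** * Arithmetic modulo 2; the half graph and its modules *)

Lemma natr_addb (b c : bool) : b%:R + c%:R = (b (+) c)%:R :> 'Z_2.
Proof. by case: b c => [] []; apply/val_inj. Qed.

Lemma opp2 (a : 'Z_2) : a = - a.
Proof. by apply/val_inj; case: a => [[|[|]]]. Qed.

(** Adjacency [|p - q| > m]: subtraction is truncated, so one of the two summands is 0. *)
Definition far (m p q : nat) : bool := (m < (p - q) + (q - p))%N.

(* Vertex m together with the first t vertices of either side of the half
   graph. *)
Definition window (m t p : nat) : bool :=
  [|| (p < t)%N, p == m | (m < p <= m + t)%N].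

(** A vertex outside [a] cannot tell two members apart. Two members on one side of [m] are told
    apart by a vertex of the other side, so [a] meets both sides. A member of each side forces in
    [0] and [m + t], and these are told apart by every vertex of the window except [m]. *)
Lemma far_module (m t : nat) (a : pred nat) : (t <= m)%N ->
  (forall i i' j, window m t i -> window m t i' -> window m t j ->
     a i -> a i' -> ~~ a j -> far m i j = far m i' j) ->
  ~~ a m -> (exists i i', [/\ window m t i, window m t i', a i, a i' & (i < i')%N]) ->
  forall j, window m t j -> ~~ a j -> j = m.
Proof.
move=> tm mod am [i [i' [wi wi' ai ai' ii']]].
have nm p : a p -> p != m by apply: contraTneq => ->.
have [p [q [pt mq ap aq]]] : exists p q, [/\ (p < t)%N, (m < q <= m + t)%N, a p & a q].
  have ni := nm _ ai; have ni' := nm _ ai'.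
  case: (ltnP i t) => hi; last first.
    (* The new vertex is at distance exactly [m + 1] from [i'], hence at most [m] from [i]. *)
    exists (i' - m.+1)%N, i'; move: wi wi'; rewrite /window => wi wi'.
    split=> //; try lia; apply/negPn/negP => nb.
    have := mod i i' (i' - m.+1)%N; rewrite /window /far; lia.
  case: (ltnP i' t) => hi'; last first.
    by exists i, i'; move: wi wi'; rewrite /window => wi wi'; split=> //; lia.
  exists i, (i + m.+1)%N; split=> //; try lia; apply/negPn/negP => nb.
  have := mod i i' (i + m.+1)%N; rewrite /window /far; lia.
have a0 : a 0%N.
  by apply/negPn/negP => nb; have := mod p q 0%N; rewrite /window /far; lia.
have at' : a (m + t)%N.
  by apply/negPn/negP => nb; have := mod p q (m + t)%N; rewrite /window /far; lia.
move=> j wj nj; apply/eqP/negPn/negP => jm.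
have := mod 0%N (m + t)%N j; move: wj; rewrite /window /far; lia.
Qed.

(** Odd 4-cycles are symmetric in [A] and its complement, so the isolated vertex [c] may be assumed
    outside [A]. If all 4-cycles through [c] are even, [A] is a module, and [far_module] leaves no
    room for a second vertex [d] outside [A]. *)
Lemma far_split (T : finType) (g : T -> nat) (m t : nat) (A : {set T}) :
  (t <= m)%N -> injective g -> (forall p, window m t p <-> exists x, g x = p) ->
  (1 < #|A|)%N -> (1 < #|~: A|)%N ->
  exists i i' j j', [/\ [/\ i \in A, i' \in A & i != i'],
    [/\ j \notin A, j' \notin A & j != j']
    & far m (g i) (g j) (+) far m (g i) (g j')
      (+) far m (g i') (g j) (+) far m (g i') (g j')].
Proof.
move=> tm g_inj gw.
wlog [c cA gc] : A / exists2 c, c \notin A & g c = m.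
  move=> wl A1 B1; have [|c gc] := (gw m).1; first by rewrite /window eqxx orbT.
  case: (boolP (c \in A)) => cA; last by apply: wl => //; exists c.
  have := wl (~: A); rewrite setCK => -[|//|//|]; first by exists c; rewrite // inE cA.
  move=> i [i' [j [j' [[hi hi' ii'] [hj hj' jj'] D]]]].
  exists j, j', i, i'; move: hi hi' hj hj'; rewrite !inE !negbK => -> -> -> ->.
  by split=> //; move: D; rewrite /far; lia.
move=> /card_gt1P[i [i' [hi hi' ii']]] /card_gt1P[j [j' [hj hj' jj']]].
rewrite !inE in hj hj'.
have [d dA dm] : exists2 d, d \notin A & g d != m.
  case: (eqVneq (g j) m) => gj; last by exists j.
  by exists j' => //; rewrite -gj (inj_eq g_inj) eq_sym.
pose D i i' j j' := far m (g i) (g j) (+) far m (g i) (g j')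
      (+) far m (g i') (g j) (+) far m (g i') (g j').
case: (boolP [exists i in A, exists i' in A, exists j in ~: A, D i i' j c]).
  move=> /exists_inP[u uA /exists_inP[u' u'A /exists_inP[v vA Dv]]].
  exists u, u', v, c; rewrite inE in vA; split=> //; split=> //.
    by apply: contraTneq Dv => ->; rewrite /D -addbA addbb.
  by apply: contraTneq Dv => ->; rewrite /D addbb addFb addbb.
move=> nD; pose a p := [exists x in A, g x == p].
have aE x : a (g x) = (x \in A).
  apply/exists_inP/idP => [[y yA /eqP/g_inj <-]//|xA]; by exists x.
have wg x : window m t (g x) by apply/gw; exists x.
have farm x : far m (g x) (g c) = false.
  by rewrite gc; have := wg x; rewrite /window /far; lia.
have amod p p' q : window m t p -> window m t p' -> window m t q ->
    a p -> a p' -> ~~ a q -> far m p q = far m p' q.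
  move=> /gw[u <-] /gw[u' <-] /gw[v <-]; rewrite !aE => uA u'A vA.
  have [//|ne] := eqVneq (far m (g u) (g v)) (far m (g u') (g v)).
  case/negP: nD.
  apply/exists_inP; exists u => //; apply/exists_inP; exists u' => //.
  apply/exists_inP; exists v; rewrite ?inE // /D !farm !addbF.
  by case: (far m (g u) (g v)) (far m (g u') (g v)) ne => [] [].
case/eqP: dm; apply: (far_module tm amod); rewrite ?aE // -?gc ?aE //.
move: ii'; rewrite gc -(inj_eq g_inj) neq_ltn => /orP[] lt.
  by exists (g i), (g i'); rewrite !aE.
by exists (g i'), (g i); rewrite !aE.
Qed.

(** * The circulant quadratic form and its graph *)

(** The formula of [fcirc] on vectors of any parity, so that it can be polarized. *)
Definition circ_form (n : nat) (x : {ffun 'I_n.+1 -> 'Z_2}) : 'Z_2 :=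
  \sum_(i < n.+1) \sum_(1 <= j < (n %/ 4).+1) x i * x (inZp (i + j)).

Definition arc (n u w : nat) : bool :=
  (0 < (if u <= w then w - u else w + n.+1 - u) <= n %/ 4)%N.

(** Cyclic distance between 1 and [n %/ 4] modulo [n + 1]. *)
Definition adj (n u w : nat) : bool :=
  (0 < (u - w) + (w - u) <= n %/ 4)%N
  || (n.+1 - n %/ 4 <= (u - w) + (w - u))%N.

Lemma adj_arc (n u w : nat) : (u <= n)%N -> (w <= n)%N ->
  (adj n u w)%:R = (arc n u w)%:R + (arc n w u)%:R :> 'Z_2.
Proof.
move=> hu hw.
rewrite natr_addb; congr (nat_of_bool _)%:R.
by rewrite /adj /arc; case: (ltngtP u w) => ?; lia.
Qed.

Lemma sum_arc (n : nat) (y : 'I_n.+1 -> 'Z_2) (u : 'I_n.+1) :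
  \sum_(1 <= j < (n %/ 4).+1) y (inZp (u + j)) = \sum_(w < n.+1) (arc n u w)%:R * y w.
Proof.
transitivity (\sum_(w < n.+1) \sum_(1 <= j < (n %/ 4).+1)
    (inZp (u + j)%N == w)%:R * y w).
  rewrite exchange_big /=; apply: eq_bigr => j _.
  rewrite (bigD1 (inZp (u + j)%N)) //= eqxx mul1r big1 ?addr0 // => w.
  by rewrite eq_sym => /negbTE ->; rewrite mul0r.
apply: eq_bigr => w _; rewrite -mulr_suml; congr (_ * _).
set d := (if (u <= w)%N then w - u else w + n.+1 - u)%N.
have jd j : (1 <= j < (n %/ 4).+1)%N -> (inZp (u + j)%N == w) = (j == d).
  move=> hj; rewrite -val_eqE /= /d.
  have := ltn_ord u; have := ltn_ord w.
  case: (ltnP (u + j) n.+1) => huj hw hu; first by rewrite modn_small //; case: leqP; lia.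
  have -> : ((u + j) %% n.+1 = u + j - n.+1)%N.
    by rewrite -[in LHS](subnK huj) modnDr modn_small //; lia.
  by case: leqP; lia.
under eq_big_nat => j hj do rewrite jd //.
have -> : arc n u w = (1 <= d < (n %/ 4).+1)%N by [].
case: (boolP (1 <= d < _)%N) => hd.
  rewrite (bigD1_seq d) ?mem_index_iota ?iota_uniq //= eqxx big1 ?addr0 // => j.
  by move/negbTE ->.
rewrite big_nat_cond big1 // => j /andP[hj _].
by case: eqP => // jE; rewrite jE (negbTE hd) in hj.
Qed.

(** Polarization: the bilinear form of [circ_form] has the adjacency matrix of the graph. *)
Lemma circ_formD (n : nat) (x y : {ffun 'I_n.+1 -> 'Z_2}) :
  circ_form (x + y) = circ_form x + circ_form y
    + \sum_(u < n.+1) \sum_(w < n.+1) (adj n u w)%:R * (x u * y w).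
Proof.
have pairE (a b : {ffun 'I_n.+1 -> 'Z_2}) :
    \sum_(i < n.+1) \sum_(1 <= j < (n %/ 4).+1) a i * b (inZp (i + j)%N)
    = \sum_(u < n.+1) \sum_(w < n.+1) (arc n u w)%:R * (a u * b w).
  apply: eq_bigr => u _; rewrite -mulr_sumr sum_arc mulr_sumr.
  by apply: eq_bigr => w _; ring.
have -> : \sum_(u < n.+1) \sum_(w < n.+1) (adj n u w)%:R * (x u * y w)
    = (\sum_(u < n.+1) \sum_(w < n.+1) (arc n u w)%:R * (x u * y w))
      + \sum_(u < n.+1) \sum_(w < n.+1) (arc n u w)%:R * (y u * x w).
  rewrite [X in _ + X]exchange_big -big_split; apply: eq_bigr => u _.
  rewrite -big_split; apply: eq_bigr => w _ /=.
  by rewrite adj_arc ?leq_ord //; ring.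
rewrite -!pairE /circ_form -!big_split; apply: eq_bigr => i _ /=.
rewrite -!big_split; apply: eq_bigr => j _ /=; rewrite !ffunE; ring.
Qed.

(* 2v mod n + 1, for even n. *)
Definition pos (n v : nat) : nat := if (v <= n./2)%N then v.*2 else (v.*2 - n.+1)%N.

(* The terms [n./2 < u] and [n./2 < w] are the effect of switching. *)
Lemma adj_far (n u w : nat) : ~~ odd n -> (u <= n)%N -> (w <= n)%N -> u != w ->
  adj n u w = ~~ far n./2 (pos n u) (pos n w) (+) (n./2 < u)%N (+) (n./2 < w)%N.
Proof.
move=> ev; rewrite -(even_halfK ev); set m := n./2; rewrite doubleK.
rewrite neq_ltn /adj /far /pos doubleK => hu hw /orP[] uw;
  case: (leqP u m) => hum; case: (leqP w m) => hwm /=; apply/idP/idP; lia.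
Qed.

(** The closed neighbourhoods of [i + r] and [i - r] are arcs ending at [i + n./2] and [i - n./2].
    They are the two halves of the cycle cut at [i], both containing [i] if [n./2] is even and
    neither if it is odd. *)
Lemma antitwins (n i : nat) : ~~ odd n -> (4 <= n)%N -> (i <= n)%N ->
  exists u v : nat, [/\ (u <= n)%N, (v <= n)%N & uniq [:: i; u; v]]
    /\ [/\ adj n u i = adj n v i &
    forall w, (w <= n)%N -> w \notin [:: i; u; v] -> adj n u w = ~~ adj n v w].
Proof.
move=> ev h4 hi; set r := (n./2 - n %/ 4)%N.
exists (if i + r < n.+1 then i + r else i + r - n.+1)%N.
exists (if r <= i then i - r else i + n.+1 - r)%N.
rewrite /= !inE /adj /r.
split; first by split; repeat case: ifP => ?; lia.
split; first by repeat case: ifP => ?; lia.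
by move=> w hw; rewrite !inE; repeat case: ifP => ?; lia.
Qed.

(** * Quasigroups given by total functions, and their retracts *)

Definition Qfun (n : nat) (alpha : 'Z_2) (F : {ffun 'I_n.+1 -> 'Z_2} -> 'Z_2) :
    quasigroup Z22 n :=
  Qlam (fun x : E n alpha => F (val x)).

Lemma Qfun_graph (n : nat) (alpha : 'Z_2) (F : {ffun 'I_n.+1 -> 'Z_2} -> 'Z_2)
    (z : {ffun 'I_n.+1 -> Z22}) :
  op_graph (Qfun alpha F) z <->
  \sum_i (z i).1 = alpha /\ \sum_i (z i).2 = F [ffun i => (z i).1].
Proof.
rewrite Qop_graphP; split=> [[x [xz sy]]|[sx sy]].
  have xE : val x = [ffun i => (z i).1] by apply/ffunP => i; rewrite ffunE.
  rewrite sy xE; split=> //; rewrite -(eqP (valP x)).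
  by apply: eq_bigr => i _; rewrite xz.
have xP : \sum_i [ffun i => (z i).1] i == alpha.
  by rewrite -sx; apply/eqP/eq_bigr => i _; rewrite ffunE.
by exists (exist _ [ffun i => (z i).1] xP : E n alpha); split=> // i; rewrite /= ffunE.
Qed.

Definition insert (n : nat) (i : 'I_n.+1) (a : 'Z_2) (x : {ffun 'I_n -> 'Z_2}) :
    {ffun 'I_n.+1 -> 'Z_2} :=
  [ffun j => if unlift i j is Some k then x k else a].

(** The retract is again a [Qfun], so variables can be fixed one after another. *)
Definition Qfix (n : nat) (alpha : 'Z_2) (F : {ffun 'I_n.+2 -> 'Z_2} -> 'Z_2)
    (i : 'I_n.+2) (a : Z22) : quasigroup Z22 n :=
  Qfun (alpha - a.1) (fun x => F (insert i a.1 x) - a.2).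

Lemma Qfix_graph (n : nat) (alpha : 'Z_2) (F : {ffun 'I_n.+2 -> 'Z_2} -> 'Z_2)
    (i : 'I_n.+2) (a : Z22) (z : {ffun 'I_n.+2 -> Z22}) : z i = a ->
  op_graph (Qfix alpha F i a) [ffun j => z (lift i j)]
    <-> op_graph (Qfun alpha F) z.
Proof.
move=> za; rewrite !Qfun_graph !(bigD1_ord i (P := xpredT)) //= za.
have -> : insert i a.1 [ffun j => ([ffun j => z (lift i j)] j).1]
    = [ffun j => (z j).1].
  apply/ffunP => j; rewrite !ffunE.
  by case: unliftP => [k|] ->; rewrite ?ffunE ?za.
have sE (g : Z22 -> 'Z_2) :
    \sum_j g ([ffun j => z (lift i j)] j) = \sum_j g (z (lift i j)).
  by apply: eq_bigr => j _; rewrite ffunE.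
rewrite (sE fst) (sE snd).
have subE (b c d : 'Z_2) : b = c - d <-> d + b = c.
  by split=> [->|<-]; [rewrite addrC subrK | rewrite addrC addKr].
by split=> -[/subE sx /subE sy].
Qed.

Lemma ltn_lift (n : nat) (i : 'I_n.+1) (j k : 'I_n) :
  (lift i j < lift i k)%N = (j < k)%N.
Proof. by rewrite !ltnNge /= leq_bump2. Qed.

Lemma mem_lift (n : nat) (i j : 'I_n.+1) :
  j \notin [set i] <-> exists k, lift i k = j.
Proof.
rewrite inE; split=> [ji|[k <-]]; last by rewrite eq_sym neq_lift.
by rewrite eq_sym in ji; case/unlift_some: ji => k jk _; exists k.
Qed.

Lemma is_retract_fix (n : nat) (alpha : 'Z_2)
    (F : {ffun 'I_n.+2 -> 'Z_2} -> 'Z_2) (i : 'I_n.+2) (a : Z22) :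
  is_retract (Qfun alpha F) [set i] (fun=> a) (Qfix alpha F i a).
Proof.
exists (lift i); split=> [j k|j|z zi]; first by rewrite ltn_lift.
  exact: mem_lift.
by apply: Qfix_graph; rewrite zi ?inE.
Qed.

Lemma is_retract_fix2 (n : nat) (alpha : 'Z_2)
    (F : {ffun 'I_n.+3 -> 'Z_2} -> 'Z_2) (u v : 'I_n.+3) (a : Z22) : u != v ->
  exists R : quasigroup Z22 n,
    is_retract (Qfun alpha F) [set u; v] (fun=> a) R.
Proof.
move=> /unlift_some[k vk _].
(* [k] is the index of [v] among the variables left after fixing [u]. *)
exists (Qfix (alpha - a.1) (fun x => F (insert u a.1 x) - a.2) k a).
exists (fun j => lift u (lift k j)); split=> [i j|j|z zi].
- by rewrite !ltn_lift.
- rewrite in_setU negb_or vk; split=> [/andP[/mem_lift[l <-]]|[i <-]].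
    rewrite inE (inj_eq lift_inj) => lk.
    have /mem_lift[i <-] : l \notin [set k] by rewrite inE.
    by exists i.
  by rewrite !inE (inj_eq lift_inj) ![lift _ _ == _]eq_sym !neq_lift.
- have zu : z u = a by rewrite zi ?inE ?eqxx.
  have zv : z v = a by rewrite zi ?inE ?eqxx ?orbT.
  rewrite -(Qfix_graph _ _ zu) -[X in _ <-> X](@Qfix_graph _ _ _ k a) ?ffunE -?vk //.
  rewrite (_ : [ffun j => z (lift u (lift k j))]
    = [ffun j => [ffun j => z (lift u j)] (lift k j)]) //.
  by apply/ffunP => j; rewrite !ffunE.
Qed.

Lemma is_retract_id (S : Type) (n : nat) (Q : quasigroup S n)
    (c : 'I_n.+1 -> S) : is_retract Q set0 c Q.
Proof.
exists id; split=> // [i|z _]; first by rewrite inE; split=> // _; exists i.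
by rewrite (_ : [ffun j => z j] = z) //; apply/ffunP => j; rewrite ffunE.
Qed.

(** * A necessary and a sufficient condition for reducibility along [A] *)

(** [Q'] sees only the part in [A] and [Q''] only the rest, so the equalities at three corners of a
    rectangle chain to the fourth. *)
Lemma set_reducible_rect (S : Type) (n : nat) (Q : quasigroup S n)
    (A : {set 'I_n.+1}) (z00 z10 z01 z11 : {ffun 'I_n.+1 -> S}) :
  set_reducible Q A ->
  {in A, z00 =1 z01} -> {in A, z10 =1 z11} ->
  {in ~: A, z00 =1 z10} -> {in ~: A, z01 =1 z11} ->
  op_graph Q z00 -> op_graph Q z10 -> op_graph Q z01 -> op_graph Q z11.
Proof.
move=> [Q' [Q'' QE]] hA0 hA1 hB0 hB1; rewrite !QE.
have restr (B : {set 'I_n.+1}) (z z' : {ffun 'I_n.+1 -> S}) : {in B, z =1 z'} ->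
    [ffun k => z (@enum_val _ (mem B) k)] = [ffun k => z' (@enum_val _ (mem B) k)].
  by move=> zz'; apply/ffunP => k; rewrite !ffunE zz' ?enum_valP.
rewrite (restr _ _ _ hA0) (restr _ _ _ hA1) (restr _ _ _ hB0) (restr _ _ _ hB1).
by move=> -> -> ->.
Qed.

Lemma sum_enum_val (T : finType) (A : {set T}) (f : T -> 'Z_2) :
  \sum_(k < #|A|) f (@enum_val _ (mem A) k) = \sum_(i in A) f i.
Proof. by rewrite [RHS]big_enum_val. Qed.

(** Both defining equations are separated into a side for [A] and a side for its complement; [Q']
    carries [G] and [Q''] carries [- H]. *)
Lemma Qfun_set_reducible (n : nat) (alpha : 'Z_2)
    (F G H : {ffun 'I_n.+1 -> 'Z_2} -> 'Z_2) (A : {set 'I_n.+1}) :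
  (forall x y : {ffun 'I_n.+1 -> 'Z_2}, {in A, x =1 y} -> G x = G y) ->
  (forall x y : {ffun 'I_n.+1 -> 'Z_2}, {in ~: A, x =1 y} -> H x = H y) ->
  (forall x : {ffun 'I_n.+1 -> 'Z_2}, \sum_i x i = alpha -> F x = G x + H x) ->
  set_reducible (Qfun alpha F) A.
Proof.
move=> Gdep Hdep FE.
(* Extension by 0 outside [B]; each sum has at most one term. Coordinate 0 of [x] is skipped: it
   belongs to the value of the operation, not to an argument. *)
pose ext (B : {set 'I_n.+1}) (x : {ffun 'I_#|B|.+1 -> 'Z_2}) :=
  [ffun i => \sum_(k < #|B| | @enum_val _ (mem B) k == i) x (lift ord0 k)].
have QE (B : {set 'I_n.+1}) beta (K : {ffun 'I_n.+1 -> 'Z_2} -> 'Z_2)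
    (z : {ffun 'I_n.+1 -> Z22}) :
    (forall x y : {ffun 'I_n.+1 -> 'Z_2}, {in B, x =1 y} -> K x = K y) ->
  Qfun beta (fun x => K (ext B x)) [ffun k => z (@enum_val _ (mem B) k)]
  = (beta - \sum_(i in B) (z i).1,
     K [ffun i => (z i).1] - \sum_(i in B) (z i).2).
  move=> Kdep; rewrite /= /Qop -!sum_enum_val.
  congr (_ - _, _ - _); try by apply: eq_bigr => k _; rewrite !ffunE.
  apply: Kdep => i iB; rewrite -(enum_rankK_in iB iB) !ffunE.
  set k0 := enum_rank_in _ _.
  rewrite (bigD1 k0) //= big1 ?addr0; first by rewrite ffunE liftK !ffunE.
  by move=> k /andP[/eqP/enum_val_inj ->]; rewrite eqxx.
exists (Qfun 0 (fun x => G (ext A x))).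
exists (Qfun alpha (fun x => - H (ext (~: A) x))) => z.
rewrite (QE A 0 G) // (QE (~: A) alpha (fun x => - H x)); last first.
  by move=> x y xy; rewrite (Hdep _ _ xy).
have split_sum (f : 'I_n.+1 -> 'Z_2) :
    \sum_i f i = \sum_(i in A) f i + \sum_(i in ~: A) f i.
  rewrite (bigID (mem A)) /=; congr (_ + _).
  by apply: eq_bigl => i; rewrite inE.
have sE : \sum_i [ffun i => (z i).1] i = \sum_i (z i).1.
  by apply: eq_bigr => i _; rewrite ffunE.
have two (a b c d : 'Z_2) : (a - b == c - d) = (b + d == a - c).
  by case: a b c d => [[|[|]]] // ? [[|[|]]] // ? [[|[|]]] // ? [[|[|]]].
rewrite Qfun_graph; split=> [[sx sy]|/eqP].
  apply/eqP; rewrite xpair_eqE !two -!split_sum sx sy opprK FE ?sE //.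
  by rewrite sub0r -opp2 !eqxx.
rewrite xpair_eqE !two -!split_sum opprK.
move=> /andP[/eqP sx /eqP sy]; rewrite sub0r -opp2 in sx.
by rewrite sx sy FE ?sE.
Qed.

(** * Irreducibility of the retracts on a window *)

Lemma natr_bool0 (b : bool) : b%:R = 0 :> 'Z_2 -> ~~ b.
Proof. by case: b. Qed.

Lemma sum_pair (T : finType) (i j : T) (f : T -> 'Z_2) : i != j ->
  \sum_x ((x == i) || (x == j))%:R * f x = f i + f j.
Proof.
move=> ij; rewrite (bigD1 i) //= (bigD1 j) 1?eq_sym //= big1 ?addr0.
  by rewrite !eqxx orbT !mul1r.
by move=> x /andP[/negbTE -> /negbTE ->]; rewrite mul0r.
Qed.

Lemma pos_leq (n v : nat) : ~~ odd n -> (v <= n)%N -> (pos n v <= n)%N.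
Proof.
move=> ev; rewrite -(even_halfK ev) /pos doubleK => hv.
by case: (leqP v) => ?; lia.
Qed.

Lemma pos_inj (n u w : nat) : ~~ odd n -> (u <= n)%N -> (w <= n)%N ->
  pos n u = pos n w -> u = w.
Proof.
move=> ev; rewrite -(even_halfK ev) /pos doubleK => hu hw.
by case: (leqP u) => ?; case: (leqP w) => ?; lia.
Qed.

Lemma pos_surj (n p : nat) : ~~ odd n -> (p <= n)%N ->
  exists v : 'I_n.+1, pos n v = p.
Proof.
move=> ev hp; exists (inord (if odd p then (p + n.+1)./2 else p./2)).
rewrite inordK /pos; last by case: ifP => op; lia.
by have nE := even_halfK ev; case: (boolP (odd p)) => op; case: leqP => ?; lia.
Qed.

(** A split along [A] would make the polar form vanish on a pair of ones in [A] against a pair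
    outside, so every 4-cycle would be even, against [far_split]. *)
Lemma irreducible_window (n m t : nat) (R : quasigroup Z22 m) : ~~ odd n ->
  (t <= n./2)%N ->
  is_retract (Qfun 0 (@circ_form n)) [set v : 'I_n.+1 | ~~ window n./2 t (pos n v)]
    (fun=> 0) R ->
  irreducible R.
Proof.
move=> ev tm [h [hmono hsurj hR]] [A [/andP[A1 Am] red]].
have hinj : injective h.
  move=> j k hjk; apply/val_inj; case: (ltngtP j k) => // /hmono.
    by rewrite hjk ltnn.
  by rewrite hjk ltnn.
have ginj : injective (fun j => pos n (h j)).
  by move=> j k /(pos_inj ev (leq_ord _) (leq_ord _))/val_inj/hinj.
have gw p : window n./2 t p <-> exists j, pos n (h j) = p.
  split=> [wp|[j <-]].
    have hp : (p <= n)%N by move: wp; rewrite /window; lia.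
    have [v vp] := pos_surj ev hp.
    have /hsurj[j hj] : v \notin [set v : 'I_n.+1 | ~~ window n./2 t (pos n v)].
      by rewrite inE vp wp.
    by exists j; rewrite hj.
  by have /hsurj := ex_intro (fun k => h k = h j) j erefl; rewrite inE negbK.
have B1 : (1 < #|~: A|)%N by have := cardsC A; rewrite card_ord; lia.
have [i [i' [j [j' [[iA i'A ii'] [jA j'A jj'] D]]]]] := far_split tm ginj gw A1 B1.
pose e k l : {ffun 'I_n.+1 -> 'Z_2} := [ffun x => ((x == h k) || (x == h l))%:R].
(* A point of the graph over the indicator of [h k] and [h l]: the whole value of the form is placed
   at [h k]. *)
pose z k l : {ffun 'I_n.+1 -> Z22} :=
  [ffun x => (e k l x, if x == h k then circ_form (e k l) else 0)].
have z1 k l : [ffun x => (z k l x).1] = e k l.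
  by apply/ffunP => x; rewrite !ffunE.
have sum1 k l : k != l -> \sum_x (z k l x).1 = 0.
  move=> kl; under eq_bigr do rewrite !ffunE -[_%:R]mulr1.
  by rewrite sum_pair ?(inj_eq hinj) //; apply/val_inj.
have sum2 k l : \sum_x (z k l x).2 = circ_form (e k l).
  rewrite (bigD1 (h k)) //= big1 ?addr0 ?ffunE ?eqxx //.
  by move=> x /negbTE xk; rewrite ffunE xk.
have zout k l x : (forall y, h y != x) -> z k l x = 0.
  move=> hx; rewrite !ffunE ![x == _]eq_sym !(negbTE (hx _)) //.
have zL k l x : x \in [set v : 'I_n.+1 | ~~ window n./2 t (pos n v)] -> z k l x = 0.
  move=> xL; apply: zout => y; apply: contraL xL => /eqP yx.
  by apply/hsurj; exists y.
have zB k l x : h k != x -> h l != x -> z k l x = 0.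
  by move=> kx lx; rewrite !ffunE ![x == _]eq_sym (negbTE kx) (negbTE lx).
pose r (y : {ffun 'I_n.+1 -> Z22}) := [ffun k => y (h k)].
have circ0 : circ_form (0 : {ffun 'I_n.+1 -> 'Z_2}) = 0.
  by rewrite /circ_form !big1 // => k _; rewrite big1 // => l _; rewrite !ffunE mul0r.
have g0 : op_graph R (r 0).
  apply/hR; first by move=> x _; rewrite ffunE.
  apply/Qfun_graph; split; first by rewrite big1 // => x _; rewrite ffunE.
  rewrite big1; last by move=> x _; rewrite ffunE.
  by rewrite -[LHS]circ0; congr circ_form; apply/ffunP => x; rewrite !ffunE.
have g1 k l : k != l -> op_graph R (r (z k l)).
  move=> kl; apply/hR; first exact: zL.
  by apply/Qfun_graph; rewrite sum1 // sum2 z1.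
have nA k l x : k \in A -> l \in A -> x \in ~: A -> z k l (h x) = 0.
  rewrite inE => kA lA xA; apply: zB; rewrite (inj_eq hinj).
    by apply: contraNneq xA => <-.
  by apply: contraNneq xA => <-.
have nB k l x : k \notin A -> l \notin A -> x \in A -> z k l (h x) = 0.
  move=> kA lA xA; apply: zB; rewrite (inj_eq hinj).
    by apply: contraNneq kA => ->.
  by apply: contraNneq lA => ->.
have rE y x : r y x = y (h x) by rewrite ffunE.
have g11 : op_graph R (r (z i i' + z j j')).
  apply: (set_reducible_rect (z00 := r 0) red _ _ _ _ g0 (g1 _ _ ii') (g1 _ _ jj')).
  - by move=> x xA; rewrite !rE nB // ffunE.
  - by move=> x xA; rewrite !rE [RHS]ffunE (nB j) // addr0.
  - by move=> x xA; rewrite !rE nA // ffunE.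
  - by move=> x xA; rewrite !rE [RHS]ffunE (nA i) // add0r.
have /Qfun_graph[_] : op_graph (Qfun 0 (@circ_form n)) (z i i' + z j j').
  by apply/hR => // x xL; rewrite ffunE !zL // addr0.
have -> : [ffun x => ((z i i' + z j j') x).1] = e i i' + e j j'.
  by apply/ffunP => x; rewrite !ffunE.
under eq_bigr do rewrite ffunE /=.
(* The values of the form at the two summands cancel; what remains is the sum of four
   adjacencies. *)
rewrite big_split /= !sum2 circ_formD -[LHS]addr0 => /addrI.
under eq_bigr => u _.
  under eq_bigr do rewrite !ffunE mulrCA [X in _ * X]mulrC.
  rewrite -mulr_sumr sum_pair ?(inj_eq hinj) //; over.
rewrite sum_pair ?(inj_eq hinj) //.
have ne k l : k \in A -> l \notin A -> h k != h l.
  by move=> kA lA; rewrite (inj_eq hinj); apply: contraNneq lA => <-.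
(* Each switching term occurs twice and the four negations cancel, which leaves the odd sum [D]. *)
rewrite !adj_far ?leq_ord ?ne //.
rewrite !natr_addb => /esym/natr_bool0.
by move: D; do 4 case: (far _ _ _) => //=; do 4 case: (_ < _)%N.
Qed.

(** * Reducibility after fixing one variable *)

(** The set [A] consists of the antitwins [u], [v], with indices [j], [k]. The cross term of the
    form is [x j * S + x k * Sv], with [S] and [Sv] the sums of [yB] over the neighbours of [u] and
    [v]. Here [Sv = S + P x - b], and parity gives [P x = x j + x k]; so it equals
    [P x * S + x k * (x j + x k - b)], a term outside [A] plus a term in [A]. *)
Lemma reducible_fix (n : nat) (i : 'I_n.+2) (a : Z22) :
  odd n -> (3 <= n)%N -> reducible (Qfix 0 (@circ_form n.+1) i a).
Proof.
move=> odn n3; have [||u0 [v0 [[hu hv]]]] := @antitwins n.+1 i _ _ (leq_ord i).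
- by rewrite /= odn.
- by [].
rewrite /= !inE !negb_or andbT => /andP[/andP[iu iv] uv] [adj_i adj_w].
pose u : 'I_n.+2 := Ordinal (hu : (u0 < n.+2)%N).
pose v : 'I_n.+2 := Ordinal (hv : (v0 < n.+2)%N).
have [j uj _] := unlift_some (iu : i != u).
have [k vk _] := unlift_some (iv : i != v).
have jk : j != k by apply: contraNneq uv => jk; rewrite -[u0]/(val u) uj jk -vk.
exists [set j; k]; rewrite cards2 jk; split=> //.
set b := a.1; pose y (A : {set 'I_n.+1}) c (x : {ffun 'I_n.+1 -> 'Z_2}) :=
  insert i c [ffun l => if l \in A then x l else 0].
pose P (x : {ffun 'I_n.+1 -> 'Z_2}) := \sum_(l in ~: [set j; k]) x l + b.
have ydep (A : {set 'I_n.+1}) c (x x' : {ffun 'I_n.+1 -> 'Z_2}) :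
    {in A, x =1 x'} -> y A c x = y A c x'.
  move=> xx'; congr insert; apply/ffunP => l; rewrite !ffunE.
  by case: ifP => // /xx'.
apply: (@Qfun_set_reducible _ _ _
  (fun x => circ_form (y [set j; k] 0 x) + x k * (x j + x k - b))
  (fun x => circ_form (y (~: [set j; k]) b x) - a.2
     + P x * \sum_(w < n.+2) (adj n.+1 u w)%:R * y (~: [set j; k]) b x w)).
- by move=> x x' xx'; rewrite (ydep _ _ _ _ xx') !xx' ?inE ?eqxx ?orbT.
- move=> x x' xx'; rewrite (ydep _ _ _ _ xx') /P.
  by congr (_ + (_ + _) * _); apply: eq_bigr => l /xx'.
move=> x sx; set yA := y [set j; k] 0 x; set yB := y _ b x.
have -> : insert i b x = yA + yB.
  apply/ffunP => l; rewrite !ffunE; case: unliftP => [l' _|_]; last by rewrite add0r.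
  by rewrite !ffunE !inE; case: ifP; rewrite ?addr0 ?add0r.
rewrite circ_formD; set S := \sum_w _ * yB _.
have yAu : yA u = x j by rewrite uj !ffunE liftK ffunE !inE eqxx.
have yAv : yA v = x k by rewrite vk !ffunE liftK ffunE !inE eqxx orbT.
have uv' : u != v by [].
have yA0 w : w != u -> w != v -> yA w = 0.
  rewrite uj vk !ffunE; case: unliftP => // l ->; rewrite !(inj_eq lift_inj).
  by rewrite ffunE !inE => /negbTE -> /negbTE ->.
have yB0 w : w = u \/ w = v -> yB w = 0.
  by rewrite uj vk => -[] ->; rewrite !ffunE liftK ffunE !inE eqxx ?orbT.
have yBi : yB i = b by rewrite ffunE unlift_none.
have PB : P x = \sum_w yB w.
  rewrite (bigD1_ord i) //= yBi addrC /P big_mkcond; congr (_ + _).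
  by apply: eq_bigr => l _; rewrite !ffunE liftK ffunE.
have PE : P x = x j + x k.
  rewrite [RHS]opp2; apply/eqP; rewrite -subr_eq0 opprK addrC /P addrA.
  have := sx; rewrite (bigID (mem [set j; k])) /= big_setU1 ?inE //= big_set1 => sx'.
  rewrite (eq_bigl (fun l => l \notin [set j; k])) ?sx' ?sub0r ?addNr // => l.
  by rewrite inE.
have Bil : \sum_(w < n.+2) \sum_(w' < n.+2) (adj n.+1 w w')%:R * (yA w * yB w')
    = x j * S + x k * \sum_(w < n.+2) (adj n.+1 v w)%:R * yB w.
  rewrite (bigD1 u) //= [X in _ + X](bigD1 v) 1?eq_sym //= [X in _ + (_ + X)]big1 ?addr0.
    rewrite /S -yAu -yAv !mulr_sumr; congr (_ + _); apply: eq_bigr => w _; ring.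
  by move=> w /andP[wu wv]; rewrite big1 // => w' _; rewrite yA0 // mul0r mulr0.
(* Away from [i] the neighbourhoods are complementary wherever [yB] is not forced to be 0; at [i]
   they agree, whence the correction [- b]. *)
have Sv : \sum_(w < n.+2) (adj n.+1 v w)%:R * yB w = S + P x - b.
  rewrite PB (bigD1 i) // [S](bigD1 i) // [\sum_w yB w](bigD1 i) //= yBi -adj_i.
  rewrite [X in _ = X](_ : _ = (adj n.+1 u0 i)%:R * b +
    (\sum_(w | w != i) (adj n.+1 u w)%:R * yB w + \sum_(w | w != i) yB w)).
    congr (_ + _); rewrite -big_split; apply: eq_bigr => w wi /=.
    have [->|wu] := eqVneq w u; first by rewrite yB0 ?mulr0 ?addr0 //; left.
    have [->|wv] := eqVneq w v; first by rewrite yB0 ?mulr0 ?addr0 //; right.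
    rewrite -[X in _ = _ + X]mul1r -mulrDl; congr (_ * _).
    rewrite (natr_addb _ true) addbT /= adj_w ?negbK ?leq_ord //.
    by rewrite !inE !negb_or; apply/and3P.
  ring.
rewrite Bil Sv PE.
ring.
Qed.

(** * Statements (a), (b) and (c) from windows and antitwins *)

Theorem theorem1 (n : nat) (hn : (4 <= n)%N) (hev : ~~ odd n) :
  irreducible (Qlam (@fcirc n)) /\
  (forall (i : 'I_n.+1) (a : Z22),
     exists R : quasigroup Z22 (n - 1),
       is_retract (Qlam (@fcirc n)) [set i] (fun=> a) R /\ reducible R) /\
  (exists (L : {set 'I_n.+1}) (c : 'I_n.+1 -> Z22) (R : quasigroup Z22 (n - 2)),
     is_retract (Qlam (@fcirc n)) L c R /\ irreducible R).
Proof.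
case: n hn hev => [|[|n]] // hn hev.
have -> : (n.+2 - 1 = n.+1)%N by rewrite subn1.
have -> : (n.+2 - 2 = n)%N by rewrite !subSS subn0.
rewrite [Qlam _](_ : _ = Qfun 0 (@circ_form n.+2)) //.
have nE := even_halfK hev; set m := (n.+2)./2 in nE.
split; [|split].
(* For [t = m] the window is all of [0, ..., 2m], so no variable is fixed. *)
- apply: (irreducible_window hev (leqnn m)).
  rewrite [X in is_retract _ X](_ : _ = set0); first exact: is_retract_id.
  apply/setP => x; rewrite !inE -/m; apply/negbF.
  by have := pos_leq hev (leq_ord x); rewrite /window; lia.
- move=> i a; exists (Qfix 0 (@circ_form n.+2) i a).
  by split; [exact: is_retract_fix | apply: reducible_fix => //; apply: negbNE].
- have [u pu] : exists u : 'I_n.+3, pos n.+2 u = m.-1 by apply: pos_surj => //; lia.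
  have [v pv] : exists v : 'I_n.+3, pos n.+2 v = m.*2 by apply: pos_surj => //; lia.
  have uv : u != v by apply: contraTneq isT => uv; move: pu; rewrite uv pv; lia.
  have [R RP] := is_retract_fix2 0 (@circ_form n.+2) 0 uv.
  exists [set u; v], (fun=> 0), R; split=> //.
  (* For [t = m - 1] the window omits exactly the positions [m - 1] and [2m]. *)
  apply: (@irreducible_window _ _ m.-1 R hev); first exact: leq_pred.
  rewrite [X in is_retract _ X](_ : _ = [set u; v]) //.
  apply/setP => x; rewrite !inE -/m.
  have posE (y : 'I_n.+3) : (x == y) = (pos n.+2 x == pos n.+2 y).
    apply/eqP/eqP => [-> //|/(pos_inj hev (leq_ord x) (leq_ord y))].
    exact: val_inj.
  rewrite !posE pu pv.
  by have := pos_leq hev (leq_ord x); rewrite /window; lia.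
Qed.
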